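(* Let $\Gamma$ be a finite graph which is connected and anti-connected. Then the isomorphism group $\mathrm{Aut}(\Gamma^e)$ of the extension graph $\Gamma^e$ contains the infinite rank free abelian group. In particular, $\mathrm{Aut}(\Gamma^e)$ is uncountable.
   Context: Graphs are simplicial. A graph is anti-connected if its complement graph is connected. $A(\Gamma)=\langle V(\Gamma)\mid [a,b]=1 \text{ for each } \{a,b\}\in E(\Gamma)\rangle$ is the right-angled Artin group on $\Gamma$. The extension graph $\Gamma^e$ has vertex set $\{v^g : v\in V(\Gamma), g\in A(\Gamma)\}$, where $v^g=g^{-1}vg$, with two distinct vertices adjacent if and only if they commute in $A(\Gamma)$. $\mathrm{Aut}(\Gamma^e)$ is the group of graph automorphisms of $\Gamma^e$ (its isomorphism group).
   Formalization: The finite graph is additionally assumed to have at least two vertices; for a one-vertex graph, which is connected and anti-connected, the extension graph is a single vertex with trivial automorphism group, so the claim fails there (likewise for the empty graph). *)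

(* Defs.v *)
From HB Require Import structures.
From mathcomp Require Import all_boot all_algebra.
From mathcomp Require Import boolp classical_sets cardinality.
From mathcomp Require Import freeg.

Set Implicit Arguments.
Unset Strict Implicit.
Unset Printing Implicit Defensive.

Local Open Scope group_scope.
Local Open Scope quotient_scope.

Definition connected_graph (V : finType) (E : rel V) : Prop :=
  forall x y : V, connect E x y.

Definition compl_graph (V : eqType) (E : rel V) : rel V :=
  [rel x y | (x != y) && ~~ E x y].

Definition anti_connected_graph (V : finType) (E : rel V) : Prop :=
  connected_graph (compl_graph E).

(* The letter (v, true) stands for the generator v and (v, false) for its
   inverse. *)
Definition word (V : Type) : Type := seq (V * bool).

Section RAAG.
Variables (V : choiceType) (E : rel V).

(* The congruence on words whose quotient is the group with generators V and
   relations [a, b] = 1 for E a b. *)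
Inductive raag_rel : word V -> word V -> Prop :=
| raag_rel_refl w : raag_rel w w
| raag_rel_sym w1 w2 : raag_rel w1 w2 -> raag_rel w2 w1
| raag_rel_trans w1 w2 w3 :
    raag_rel w1 w2 -> raag_rel w2 w3 -> raag_rel w1 w3
| raag_rel_cancel s t v b :
    raag_rel (s ++ [:: (v, b); (v, ~~ b)] ++ t) (s ++ t)
| raag_rel_comm s t a b : E a b ->
    raag_rel (s ++ [:: (a, true); (b, true)] ++ t)
             (s ++ [:: (b, true); (a, true)] ++ t).

Definition raag_eqb : rel (word V) := fun w1 w2 => `[< raag_rel w1 w2 >].

Lemma raag_eqb_refl : reflexive raag_eqb.
Proof. by move=> w; apply/asboolP; apply: raag_rel_refl. Qed.

Lemma raag_eqb_sym : symmetric raag_eqb.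
Proof. by move=> w1 w2; apply/asboolP/asboolP; apply: raag_rel_sym. Qed.

Lemma raag_eqb_trans : transitive raag_eqb.
Proof.
move=> w2 w1 w3 /asboolP h12 /asboolP h23.
by apply/asboolP; apply: raag_rel_trans h23.
Qed.

Canonical raag_equiv :=
  EquivRel raag_eqb raag_eqb_refl raag_eqb_sym raag_eqb_trans.

Definition raag : Type := {eq_quot raag_equiv}.

HB.instance Definition _ := Choice.on raag.
HB.instance Definition _ := Quotient.on raag.

Definition raag_of_word (w : word V) : raag := \pi_raag w.

Definition inv_word (w : word V) : word V :=
  rev [seq (x.1, ~~ x.2) | x <- w].

Lemma raag_of_wordP w1 w2 :
  raag_of_word w1 = raag_of_word w2 <-> raag_rel w1 w2.
Proof.
split; first by move/eqquotP => /= /asboolP.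
by move=> h; apply/eqquotP => /=; apply/asboolP.
Qed.

Lemma raag_of_word_repr (x : raag) : raag_of_word (repr x) = x.
Proof. exact: reprK. Qed.

Lemma raag_rel_repr w : raag_rel (repr (raag_of_word w)) w.
Proof. by apply/raag_of_wordP; rewrite raag_of_word_repr. Qed.

Lemma raag_rel_catl u w1 w2 :
  raag_rel w1 w2 -> raag_rel (u ++ w1) (u ++ w2).
Proof.
elim=> [w|w1' w2' _|w1' w2' w3' _ h1 _ h2|s t v b|s t a b Eab].
- exact: raag_rel_refl.
- exact: raag_rel_sym.
- exact: raag_rel_trans h1 h2.
- by rewrite !(catA u); apply: raag_rel_cancel.
- by rewrite !(catA u); apply: raag_rel_comm.
Qed.

Lemma raag_rel_catr u w1 w2 :
  raag_rel w1 w2 -> raag_rel (w1 ++ u) (w2 ++ u).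
Proof.
elim=> [w|w1' w2' _|w1' w2' w3' _ h1 _ h2|s t v b|s t a b Eab].
- exact: raag_rel_refl.
- exact: raag_rel_sym.
- exact: raag_rel_trans h1 h2.
- by rewrite -!catA; apply: raag_rel_cancel.
- by rewrite -!catA; apply: raag_rel_comm.
Qed.

Lemma raag_rel_cat u1 u2 w1 w2 :
  raag_rel u1 u2 -> raag_rel w1 w2 -> raag_rel (u1 ++ w1) (u2 ++ w2).
Proof.
move=> hu hw; apply: (@raag_rel_trans _ (u2 ++ w1)).
  exact: raag_rel_catr.
exact: raag_rel_catl.
Qed.

Lemma inv_word_cat w1 w2 : inv_word (w1 ++ w2) = inv_word w2 ++ inv_word w1.
Proof. by rewrite /inv_word map_cat rev_cat. Qed.

Lemma inv_wordK : involutive inv_word.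
Proof.
move=> w; rewrite /inv_word map_rev revK -map_comp.
by rewrite -[RHS]map_id; apply: eq_map => -[v b] /=; rewrite negbK.
Qed.

Lemma raag_rel_mulwV w : raag_rel (w ++ inv_word w) [::].
Proof.
elim: w => [|[v b] w IH]; first exact: raag_rel_refl.
have -> : inv_word ((v, b) :: w) = inv_word w ++ [:: (v, ~~ b)].
  by rewrite -cat1s inv_word_cat.
apply: raag_rel_trans (raag_rel_cancel [::] [::] v b).
rewrite /= catA -(cat1s (v, b) (_ ++ _)) -(cat1s (v, b) [:: _]).
exact/raag_rel_catl/(raag_rel_catr _ IH).
Qed.

Lemma raag_rel_mulVw w : raag_rel (inv_word w ++ w) [::].
Proof. by rewrite -{2}(inv_wordK w); apply: raag_rel_mulwV. Qed.

Lemma raag_rel_inv w1 w2 :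
  raag_rel w1 w2 -> raag_rel (inv_word w1) (inv_word w2).
Proof.
move=> h.
have h1 : raag_rel (inv_word w1) (inv_word w1 ++ w2 ++ inv_word w2).
  apply: raag_rel_sym; rewrite -{2}(cats0 (inv_word w1)).
  exact/raag_rel_catl/raag_rel_mulwV.
apply: raag_rel_trans h1 _; rewrite catA -{2}(cat0s (inv_word w2)).
apply: raag_rel_catr; apply: raag_rel_trans (raag_rel_mulVw w1).
exact/raag_rel_catl/raag_rel_sym.
Qed.

Definition raag_mul (x y : raag) : raag := raag_of_word (repr x ++ repr y).
Definition raag_one : raag := raag_of_word [::].
Definition raag_inv (x : raag) : raag := raag_of_word (inv_word (repr x)).

Lemma raag_mulE w1 w2 :
  raag_mul (raag_of_word w1) (raag_of_word w2) = raag_of_word (w1 ++ w2).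
Proof. by apply/raag_of_wordP; apply: raag_rel_cat; apply: raag_rel_repr. Qed.

Lemma raag_invE w : raag_inv (raag_of_word w) = raag_of_word (inv_word w).
Proof. by apply/raag_of_wordP/raag_rel_inv/raag_rel_repr. Qed.

Lemma raag_mulA : associative raag_mul.
Proof.
move=> x y z; rewrite -(raag_of_word_repr x) -(raag_of_word_repr y).
by rewrite -(raag_of_word_repr z) !raag_mulE catA.
Qed.

Lemma raag_mul1 : left_id raag_one raag_mul.
Proof. by move=> x; rewrite -(raag_of_word_repr x) raag_mulE. Qed.

Lemma raag_mulr1 : right_id raag_one raag_mul.
Proof. by move=> x; rewrite -(raag_of_word_repr x) raag_mulE cats0. Qed.

Lemma raag_mulV : left_inverse raag_one raag_inv raag_mul.
Proof.
move=> x; rewrite -(raag_of_word_repr x) raag_invE raag_mulE.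
exact/raag_of_wordP/raag_rel_mulVw.
Qed.

Lemma raag_mulrV : right_inverse raag_one raag_inv raag_mul.
Proof.
move=> x; rewrite -(raag_of_word_repr x) raag_invE raag_mulE.
exact/raag_of_wordP/raag_rel_mulwV.
Qed.

HB.instance Definition _ :=
  isGroup.Build raag raag_mulA raag_mul1 raag_mulr1 raag_mulV raag_mulrV.

Definition raag_gen (v : V) : raag := raag_of_word [:: (v, true)].

Lemma raag_gen_commute (a b : V) :
  E a b -> commute (raag_gen a) (raag_gen b).
Proof.
move=> Eab; rewrite /commute [LHS]raag_mulE [RHS]raag_mulE.
exact/raag_of_wordP/(raag_rel_comm [::] [::]).
Qed.

(* [x ^ g] is [g^-1 * (x * g)]. *)
Definition ext_vertex : Type :=
  {x : raag | `[< exists v g, x = raag_gen v ^ g >]}.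

HB.instance Definition _ := Choice.on ext_vertex.

Definition ext_graph : rel ext_vertex :=
  [rel x y | (x != y) && (sval x * sval y == sval y * sval x)].

End RAAG.

Arguments ext_graph {V} E.

Section GraphAut.
Variables (T : choiceType) (e : rel T).

(* The inverse is stored as data; it is determined by [aut_fun]
   (see [graph_aut_eq]). *)
Record graph_aut : Type := GraphAut {
  aut_fun :> T -> T;
  aut_inv : T -> T;
  aut_funK : cancel aut_fun aut_inv;
  aut_invK : cancel aut_inv aut_fun;
  aut_edge : forall x y, e (aut_fun x) (aut_fun y) = e x y }.

Lemma graph_aut_eq (f g : graph_aut) : f =1 g -> f = g.
Proof.
case: f g => [f f' fK f'K fe] [g g' gK g'K ge] /= fg.
have {}fg : f = g by apply/funext.
subst g; have f'g' : f' = g' by apply/funext => x; rewrite -{1}(g'K x) fK.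
subst g'; congr GraphAut; exact: Prop_irrelevance.
Qed.

HB.instance Definition _ := gen_eqMixin graph_aut.
HB.instance Definition _ := gen_choiceMixin graph_aut.

Definition aut_one : graph_aut :=
  @GraphAut id id (fun=> erefl) (fun=> erefl) (fun _ _ => erefl).

Lemma aut_mul_edge (f g : graph_aut) x y : e (f (g x)) (f (g y)) = e x y.
Proof. by rewrite !aut_edge. Qed.

Definition aut_mul (f g : graph_aut) : graph_aut :=
  @GraphAut (f \o g) (aut_inv g \o aut_inv f)
    (can_comp (@aut_funK f) (@aut_funK g))
    (can_comp (@aut_invK g) (@aut_invK f)) (aut_mul_edge f g).

Lemma aut_inv_edge (f : graph_aut) x y : e (aut_inv f x) (aut_inv f y) = e x y.
Proof. by rewrite -(aut_edge f) !aut_invK. Qed.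

Definition aut_V (f : graph_aut) : graph_aut :=
  @GraphAut (aut_inv f) f (@aut_invK f) (@aut_funK f) (aut_inv_edge f).

Lemma aut_mulA : associative aut_mul.
Proof. by move=> f g h; apply: graph_aut_eq. Qed.

Lemma aut_mul1 : left_id aut_one aut_mul.
Proof. by move=> f; apply: graph_aut_eq. Qed.

Lemma aut_mulr1 : right_id aut_one aut_mul.
Proof. by move=> f; apply: graph_aut_eq. Qed.

Lemma aut_mulV : left_inverse aut_one aut_V aut_mul.
Proof. by move=> f; apply: graph_aut_eq => x /=; rewrite aut_funK. Qed.

Lemma aut_mulrV : right_inverse aut_one aut_V aut_mul.
Proof. by move=> f; apply: graph_aut_eq => x /=; rewrite aut_invK. Qed.

HB.instance Definition _ :=
  isGroup.Build graph_aut aut_mulA aut_mul1 aut_mulr1 aut_mulV aut_mulrV.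

End GraphAut.

(* [{freeg nat}] is the group of finitely supported functions nat -> int, that
   is, the free abelian group of countably infinite rank. *)
Definition contains_free_abelian_infinite_rank (G : groupType) : Prop :=
  exists f : {freeg nat} -> G,
    injective f /\ forall x y : {freeg nat}, f (x + y)%R = f x * f y.

(* Main.v *)
Require Import Defs.
From mathcomp Require Import all_boot all_algebra.
From mathcomp Require Import boolp classical_sets cardinality.
From mathcomp Require Import freeg zify ring.

Set Implicit Arguments.
Unset Strict Implicit.
Unset Printing Implicit Defensive.

Import GRing.Theory Num.Theory.

(** Anti-connectedness gives two distinct generators [v] and [w] that are not
adjacent.  Let [C] be the subgroup generated by the star of [v], so that [v] is
central in [C].  In the cube complex whose edges join [g] to [s g], where [s]
is a generator or its inverse, the hyperplanes dual to the edges from [c] to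
[v c] with [c] in [C] are pairwise disjoint and form a chain indexed by the
integers.  They cut the group into regions, and [sheet g] is the index of the
region of [g] relative to that of the identity: along a path from [1] to [g] it
counts, with signs, the letters [v] read at a point of [C].  Right
multiplication by [v] shifts all the regions by one.

If a vertex [x = z ^ h] of the extension graph is outside [C], then both [x] and
its inverse lie in the region of [h] ([sheet_conj_letter], [sheet_vertexV]), and
right multiplication by [x] sends every other region into that one
([sheet_ping_pong]).  Hence two commuting vertices outside [C] lie in the same
region ([sheet_commute]): the index is constant on each component of the
extension graph with the vertices of [C] removed.  The vertices in [C] are
fixed by conjugation by [v].  Conjugation by powers of [v] can therefore be
applied with an exponent depending on the region, and the result still
preserves adjacency: this is [twist], a shearing of the extension graph along
the vertices that commute with [v].

Conjugation by [v ^+ k] moves the region [n] to [n + k].  To obtain commuting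
automorphisms, the region [n] of 2-adic valuation [j] is moved by
[c j * 2 ^+ j.+1], which does not change the valuation; so the exponent of a
second twist is the same before and after the first one, and [c |-> twist c] is
a homomorphism from the group of all integer sequences ([twistD]).  It is
injective, because the conjugates of [w] by powers of [v] meet every region
([ext_twist_inj]).  The finitely supported sequences form a free abelian group
of infinite rank, and there are uncountably many sequences. *)

(** * Integer powers in a group *)

Section IntegerPowers.
Local Open Scope group_scope.
Variable G : groupType.
Implicit Types (g : G) (i j : int).

Definition expgz g i : G :=
  match i with Posz n => g ^+ n | Negz n => g ^- n.+1 end.

Lemma expgzDn g i (n : nat) : expgz g (i + n%:Z)%R = expgz g i * g ^+ n.
Proof.
case: i => m /=; first by rewrite -expgnDr.
case: (leqP n m) => h.
  have -> : (Negz m + n%:Z = Negz (m - n))%R by lia.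
  have e : m.+1 = n + (m - n).+1 by lia.
  by rewrite /= [in RHS]e expgnDr invgM mulgVK.
have -> : (Negz m + n%:Z = Posz (n - m.+1))%R by lia.
by rewrite -{2}(subnKC h) expgnDr mulKg.
Qed.

Lemma expgzD g i j : expgz g (i + j)%R = expgz g i * expgz g j.
Proof.
case: j => n; first exact: expgzDn.
apply: (@mulIg _ (g ^+ n.+1)); rewrite /= mulgVK -expgzDn.
by congr expgz; lia.
Qed.

End IntegerPowers.

(** * Translations of the 2-adic classes of the integers *)

Section TwoAdic.
Local Open Scope ring_scope.

Definition val2 (n : int) : nat := logn 2 `|n|.

(** The translation length on the integers of 2-adic valuation [j] is a multiple
of [2 ^+ j.+1], the period of that class.  The integer 0 has no valuation and
stays in place. *)
Definition displacement (c : nat -> int) (n : int) : int :=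
  if n == 0 then 0 else c (val2 n) * 2 ^+ (val2 n).+1.

Lemma val2_odd (k : nat) (m : int) : val2 (2 ^+ k * (1 + 2 * m)) = k.
Proof.
rewrite /val2 abszM abszX lognM ?expn_gt0 //; last by rewrite absz_gt0; lia.
rewrite lognX /= muln1 (_ : logn 2 `|_| = 0)%N ?addn0 //.
by rewrite logn_coprime // coprime2n; lia.
Qed.

Lemma two_adic_form (n : int) :
  n != 0 -> exists m, n = 2 ^+ val2 n * (1 + 2 * m).
Proof.
move=> n0; have an : (0 < `|n|)%N by rewrite absz_gt0.
have [q /=] := pfactor_coprime (isT : prime 2) an.
rewrite coprime2n -/(val2 n) => oq e.
have e' : (`|n|%:Z = 2 ^+ val2 n * q%:Z).
  by rewrite e PoszM mulrC -natrX natz.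
have qE : q%:Z = 1 + 2 * (q./2)%:Z by lia.
case: (lerP 0 n) => h.
  by exists (q./2)%:Z; rewrite -qE -e'; lia.
by exists (- (q./2)%:Z - 1); rewrite (_ : 1 + _ = - q%:Z) ?mulrN -?e'; lia.
Qed.

Lemma displacementD c d n :
  displacement (fun i => c i + d i) n = displacement c n + displacement d n.
Proof. by rewrite /displacement; case: ifP => _; rewrite ?addr0 ?mulrDl. Qed.

(** The map [n |-> n + displacement c n] preserves the 2-adic valuation; this is
what makes these translations add up. *)
Lemma displacement_shift c d n :
  let n' := n + displacement c n in
  displacement d n' = displacement d n.
Proof.
rewrite /= {2 3}/displacement; case: eqVneq => [->|n0].
  by rewrite addr0 /displacement eqxx.
have [m e] := two_adic_form n0.
set n' := n + _.
have e' : n' = 2 ^+ val2 n * (1 + 2 * (m + c (val2 n))).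
  by rewrite /n' {1}e exprS; ring.
have v' : val2 n' = val2 n by rewrite e' val2_odd.
have n'0 : n' != 0.
  rewrite e' mulf_neq0 ?expf_neq0 //; lia.
by rewrite /displacement (negPf n'0) v'.
Qed.

End TwoAdic.

(** * The subgroup generated by the star of a vertex *)

Section Sheets.
Local Open Scope group_scope.
Variables (V : choiceType) (E : rel V) (E_sym : symmetric E) (v : V).
Local Notation A := (raag E).
Local Notation "[ 'el' w ]" := (raag_of_word E w) (format "[ 'el'  w ]").
Local Notation gen := (@raag_gen V E).
Implicit Types (g h x y : raag E) (u w s t : word V).

Lemma el_cat s t : [el s ++ t] = [el s] * [el t].
Proof. by rewrite [RHS]raag_mulE. Qed.

Lemma el_cons a t : [el a :: t] = [el [:: a]] * [el t].
Proof. by rewrite -el_cat. Qed.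

Lemma el_inv s : [el inv_word s] = [el s]^-1.
Proof. by rewrite [RHS]raag_invE. Qed.

Lemma el_letterV a b : [el [:: (a, ~~ b)]] = [el [:: (a, b)]]^-1.
Proof. by rewrite -el_inv. Qed.

Lemma el_surj g : exists u, g = [el u].
Proof. by exists (repr g); rewrite raag_of_word_repr. Qed.

Definition in_star : pred (V * bool) := fun a => (a.1 == v) || E v a.1.

Definition star_subgroup : pred (raag E) :=
  fun g => `[< exists2 u, all in_star u & g = [el u] >].
Local Notation C := star_subgroup.

Lemma all_in_star_inv u : all in_star (inv_word u) = all in_star u.
Proof. by rewrite /inv_word all_rev all_map. Qed.

Lemma star_el u : all in_star u -> C [el u].
Proof. by move=> hu; apply/asboolP; exists u. Qed.

Lemma starM g h : C g -> C h -> C (g * h).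
Proof.
move=> /asboolP[u hu ->] /asboolP[w hw ->].
by rewrite -el_cat star_el // all_cat hu.
Qed.

Lemma starVimp g : C g -> C g^-1.
Proof.
by move=> /asboolP[u hu ->]; rewrite -el_inv star_el // all_in_star_inv.
Qed.

Lemma starV g : C g^-1 = C g.
Proof. by apply/idP/idP => /starVimp; rewrite ?invgK. Qed.

Lemma starMl g h : C g -> C (g * h) = C h.
Proof.
move=> hg; apply/idP/idP => h1; last exact: starM.
by rewrite -(mulKg g h) starM // starV.
Qed.

Lemma starMr g h : C h -> C (g * h) = C g.
Proof.
move=> hh; apply/idP/idP => h1; last exact: starM.
by rewrite -(mulgK h g) starM // starV.
Qed.

Lemma star_letter b : C [el [:: (v, b)]].
Proof. by apply: star_el; rewrite /= /in_star eqxx. Qed.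

Lemma star_gen : C (gen v).
Proof. exact: star_letter. Qed.

Lemma starJ g h : C h -> C (g ^ h) = C g.
Proof. by move=> hh; rewrite conjgE starMl ?starV // starMr. Qed.

Lemma star_commute g : C g -> commute g (gen v).
Proof.
move=> /asboolP[u hu ->]; elim: u hu => [|[a b] u IH] /=.
  by move=> _; rewrite /commute -[[el [::]]]/(1 : A) mul1g mulg1.
case/andP=> ha /IH hu; rewrite el_cons; apply/commute_sym/commuteM; last first.
  exact: commute_sym.
have ca : commute (gen v) (gen a).
  have /orP[/eqP -> //|] : (a == v) || E v a := ha.
  exact: raag_gen_commute.
case: b ha => _; first exact: ca.
by rewrite (el_letterV a true); apply: commuteV.
Qed.

(** * Regions cut out by the hyperplanes of the star *)

Definition sign_of (b : bool) : int := (if b then 1 else - 1)%R.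

(** The word is read from right to left, as the path that starts at the identity
and multiplies by one more letter on the left at each step. *)
Fixpoint sheet_word u : int :=
  if u is (a, b) :: t then
    (sheet_word t + (if (a == v) && C [el t] then sign_of b else 0))%R
  else 0%R.

Lemma sheet_word_catl s u w :
  raag_rel E u w -> sheet_word u = sheet_word w ->
  sheet_word (s ++ u) = sheet_word (s ++ w).
Proof.
move=> uw e; elim: s => //= -[a b] s ->.
by rewrite !el_cat (proj2 (raag_of_wordP E u w) uw).
Qed.

(** If [v] commutes with a letter, this letter belongs to [C], and multiplying by
it does not change whether the letter [v] is read at a point of [C]. *)
Lemma sheet_word_rel u w : raag_rel E u w -> sheet_word u = sheet_word w.
Proof.
elim=> [//|? ? _ //|? ? ? _ -> _ -> //|s t a b|s t a b Eab].
  apply: sheet_word_catl; first exact: (raag_rel_cancel E [::]).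
  rewrite /= (el_cons _ t); case: eqVneq => [->|_] /=; last by rewrite !addr0.
  by rewrite starMl ?star_letter //; case: C; case: b => /=; lia.
apply: sheet_word_catl; first exact: (raag_rel_comm [::]).
rewrite /= !(el_cons _ t).
have ha : b == v -> C [el [:: (a, true)]].
  by move=> /eqP e; apply: star_el; rewrite /= /in_star /= -e E_sym Eab orbT.
have hb : a == v -> C [el [:: (b, true)]].
  by move=> /eqP e; apply: star_el; rewrite /= /in_star /= -e Eab orbT.
case: (a =P v) ha hb => [->|_] ha hb; case: eqP ha => [->|_] ha /=;
  rewrite ?addr0 // ?starMl ?star_letter // ?ha ?hb //.
Qed.

Definition sheet g : int := sheet_word (repr g).

Lemma sheet_el u : sheet [el u] = sheet_word u.
Proof. exact/sheet_word_rel/raag_rel_repr. Qed.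

Lemma sheet1 : sheet 1 = 0%R.
Proof. exact: (sheet_el [::]). Qed.

Lemma sheet_letter a b g :
  sheet ([el [:: (a, b)]] * g) =
  (sheet g + (if (a == v) && C g then sign_of b else 0))%R.
Proof. by have [u ->] := el_surj g; rewrite -el_cat !sheet_el. Qed.

(** A path from [x] to [c * x] spelled with letters of the star stays in the
coset [C x], which is disjoint from [C], and crosses no hyperplane. *)
Lemma sheet_starM c x : C c -> ~~ C x -> sheet (c * x) = sheet x.
Proof.
move=> /asboolP[u hu ->] nx; elim: u hu => [|[a b] u IH] /=.
  by move=> _; rewrite mul1g.
case/andP=> ha hu; rewrite el_cons -mulgA sheet_letter IH //.
by rewrite starMl ?star_el // (negPf nx) andbF addr0.
Qed.

(** Since [v] lies in [C], a path from [1] to [g] and its right translate by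
[v] cross the hyperplanes at the same steps; the 1 is the step from [1] to [v]. *)
Lemma sheet_mulv g : sheet (g * gen v) = (sheet g + 1)%R.
Proof.
have [u ->] := el_surj g; elim: u => [|[a b] u IH].
  rewrite mul1g -[gen v]mulg1 sheet_letter sheet1 eqxx.
  by rewrite (star_el (u := [::])) //= sheet1.
rewrite el_cons -mulgA !sheet_letter IH starMr ?star_gen //.
by rewrite addrAC.
Qed.

Lemma sheet_mulvz g (k : int) : sheet (g * expgz (gen v) k) = (sheet g + k)%R.
Proof.
have nat_case h (n : nat) : sheet (h * gen v ^+ n) = (sheet h + n%:Z)%R.
  elim: n => [|n IH]; first by rewrite expg0 mulg1 addr0.
  by rewrite expgSr mulgA sheet_mulv IH; lia.
case: k => n; first exact: nat_case.
apply: (addIr (n.+1%:Z)%R); rewrite -nat_case /= mulgVK; lia.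
Qed.

Lemma sheet_vz (k : int) : sheet (expgz (gen v) k) = k.
Proof. by rewrite -[expgz _ _]mul1g sheet_mulvz sheet1 add0r. Qed.

Lemma star_vz (k : int) : C (expgz (gen v) k).
Proof.
have nat_case (n : nat) : C (gen v ^+ n).
  elim: n => [|n IH]; first by apply: (star_el (u := [::])).
  by rewrite expgS starM ?star_gen.
by case: k => n //=; rewrite starV; apply: nat_case.
Qed.

Lemma sheetJ x (k : int) :
  ~~ C x -> sheet (x ^ expgz (gen v) k) = (sheet x + k)%R.
Proof.
move=> nx; rewrite conjgE mulgA sheet_mulvz sheet_starM //.
by rewrite starV star_vz.
Qed.

Lemma sheet_crossing u g :
  sheet ([el u] * g) <> sheet g ->
  exists s b t, u = s ++ (v, b) :: t /\ C ([el t] * g).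
Proof.
elim: u => [|[a b] u IH]; first by rewrite mul1g.
rewrite el_cons -mulgA sheet_letter.
case: eqP => [->|_]; last first.
  by rewrite addr0 => /IH[s [b' [t [-> h]]]]; exists ((a, b) :: s), b', t.
case: (boolP (C _)) => h; first by move=> _; exists [::], b, u.
by rewrite addr0 => /IH[s [b' [t [-> h']]]]; exists ((v, b) :: s), b', t.
Qed.

(** Write [y] for the letter.  Multiplying [h] by [y] on the left does not change
the sheet, so if the sheet of [y ^ h] is not that of [h], the path from [y h] to
[y ^ h] passes through an element of [C].  This element gives a spelling of
[y h] with fewer letters outside the star than [h].  As [y h] conjugates [y] to
the same element as [h] does and has the same sheet, induction on the number of
such letters concludes. *)
Lemma sheet_conj_letter z b h :
  ~~ C ([el [:: (z, b)]] ^ h) -> sheet ([el [:: (z, b)]] ^ h) = sheet h.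
Proof.
set y := [el _]; have [u ->] := el_surj h.
have [n] := ubnP (count (predC in_star) u).
elim: n u => // n IH u le_u nx.
have yu : sheet (y * [el u]) = sheet [el u].
  rewrite sheet_letter; case: eqP => [ez|_] /=; last by rewrite addr0.
  case: (boolP (C [el u])) => [cu|_]; last by rewrite addr0.
  by case/negP: nx; rewrite starJ // /y ez star_letter.
have [e|/eqP] := eqVneq (sheet (y ^ [el u])) (sheet [el u]); first exact: e.
rewrite -{1}yu {1}conjgE -el_inv => /sheet_crossing[s [b' [t [e ct]]]].
have eu : u = inv_word t ++ (v, ~~ b') :: inv_word s.
  rewrite -(inv_wordK u) e inv_word_cat -cat1s inv_word_cat -catA.
  by congr (_ ++ _).
(* With [h = p q] and [t = p^-1], the element [t y h] of [C] is spelled by [w],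
   so [y h = p w], where [w] has only letters of the star. *)
case/asboolP: (ct) => w hw ew.
have yuE : y * [el u] = [el inv_word t ++ w].
  by rewrite el_cat -ew el_inv mulKg.
have same : y ^ [el u] = y ^ [el inv_word t ++ w].
  by rewrite -yuE conjgM (conjgE y y) mulKg.
(* If [q] had only letters of the star, it would be in [C], and so would
   [y ^ h = q^-1 (p^-1 y p q)]. *)
have bad : (0 < count (predC in_star) (inv_word s))%N.
  rewrite -has_count has_predC; apply/negP => hs.
  have cu : C ([el t] * [el u]).
    rewrite eu el_cat el_inv mulVKg el_cons starM ?star_letter //.
    exact: star_el.
  case/negP: nx.
  have -> : y ^ [el u] = ([el t] * [el u])^-1 * ([el t] * (y * [el u])).
    by rewrite invgM -mulgA mulKg conjgE.
  by rewrite starM // starV.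
rewrite same IH -?same // -?yuE //.
move: le_u; rewrite eu !count_cat /= ltnS.
have -> : count (predC in_star) w = 0%N.
  by apply/eqP; rewrite -leqn0 leqNgt -has_count has_predC hw.
by rewrite addn0; apply: leq_trans; lia.
Qed.

(** * Vertices of the extension graph outside the star *)

Definition is_vertex x : Prop := exists z g, x = gen z ^ g.

Lemma sheet_vertexV x : is_vertex x -> ~~ C x -> sheet x^-1 = sheet x.
Proof.
move=> [z [g ->]] nx; rewrite (sheet_conj_letter nx) -conjVg.
have nx' : ~~ C ([el [:: (z, false)]] ^ g).
  by rewrite (el_letterV z true) conjVg starV.
by rewrite -(sheet_conj_letter nx') (el_letterV z true).
Qed.

(** Follow the two paths to [g] and to [g * x] spelled by the same word.  When
the first one crosses a hyperplane it is at a point of [C], so the second one is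
in [C x], which lies in the region of [x]; when the second one crosses, the
first one is in [C x^-1], which lies in the region of [x^-1]. *)
Lemma sheet_ping_pong x g :
  ~~ C x -> sheet x^-1 = sheet x -> sheet g = sheet x \/ sheet (g * x) = sheet x.
Proof.
move=> nx eV; have [u ->] := el_surj g; elim: u => [|[a b] u IH].
  by right; rewrite mul1g.
rewrite el_cons -mulgA !sheet_letter; case: eqP => _ /=; last first.
  by rewrite !addr0.
case: (boolP (C [el u])) => [cu|nu].
  right; rewrite starMl // (negPf nx) addr0.
  exact: sheet_starM.
case: (boolP (C ([el u] * x))) => [cux|_]; last by rewrite !addr0.
left; rewrite addr0 -[[el u]](mulgK x) -eV.
by rewrite sheet_starM ?starV.
Qed.

(** If the sheets differ, start from a point [g] in neither region.  The
products [g x y] and [g y x] then lie in the regions of [y] and of [x]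
respectively. *)
Lemma sheet_commute x y :
  is_vertex x -> is_vertex y -> ~~ C x -> ~~ C y -> commute x y ->
  sheet x = sheet y.
Proof.
move=> vx vy nx ny cxy; apply/eqP/negP => /negP/eqP nxy.
pose g := expgz (gen v) (`|sheet x| + `|sheet y| + 1)%R.
have gx : sheet g <> sheet x by rewrite sheet_vz; lia.
have gy : sheet g <> sheet y by rewrite sheet_vz; lia.
have pp := sheet_ping_pong _ nx (sheet_vertexV vx nx).
have qq := sheet_ping_pong _ ny (sheet_vertexV vy ny).
have [//|gxE] := pp g; have [//|gyE] := qq g.
have [e|e] := qq (g * x); first by apply: nxy; rewrite -gxE.
have [e'|e'] := pp (g * y); first by apply: nxy; rewrite -gyE.
by apply: nxy; rewrite -e -e' -!mulgA cxy.
Qed.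

(** * Twists of the extension graph *)

Definition twist (c : nat -> int) x :=
  if C x then x else x ^ expgz (gen v) (displacement c (sheet x)).

Lemma star_twist c x : C (twist c x) = C x.
Proof. by rewrite /twist; case: ifP => // h; rewrite starJ ?star_vz. Qed.

Lemma sheet_twist c x :
  ~~ C x -> sheet (twist c x) = (sheet x + displacement c (sheet x))%R.
Proof. by move=> nx; rewrite /twist (negPf nx) sheetJ. Qed.

Lemma twistD (c d : nat -> int) x :
  twist (fun i => c i + d i)%R x = twist c (twist d x).
Proof.
rewrite {2}/twist star_twist; case: ifP => [h|/negbT h].
  by rewrite /twist h.
rewrite sheet_twist // displacement_shift /twist (negPf h) -conjgM -expgzD.
by rewrite displacementD addrC.
Qed.

Lemma twist0 x : twist (fun=> 0%R) x = x.
Proof.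
rewrite /twist /displacement; case: ifP => // _.
by rewrite mul0r if_same /= expg0 conjg1.
Qed.

Lemma twist_vertex c x : is_vertex x -> is_vertex (twist c x).
Proof.
move=> [z [g ->]]; rewrite /twist; case: ifP => _; first by exists z, g.
by rewrite -conjgM; eexists; eexists.
Qed.

Lemma star_commute_z x (k : int) : C x -> x ^ expgz (gen v) k = x.
Proof.
move=> cx; suff e : commute x (expgz (gen v) k) by rewrite conjgE e mulKg.
case: k => n /=.
  exact/commuteX/star_commute.
exact/commuteV/commuteX/star_commute.
Qed.

(** When both elements are outside [C] they have the same sheet, hence are
conjugated by the same element; when one is in [C], conjugation by a power of
[v] fixes it, so both can be considered as conjugated by the exponent of the
other. *)
Lemma twist_commute c x y :
  is_vertex x -> is_vertex y -> commute x y -> commute (twist c x) (twist c y).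
Proof.
move=> vx vy cxy.
have J k : commute (x ^ expgz (gen v) k) (y ^ expgz (gen v) k).
  by rewrite /commute -!conjMg cxy.
rewrite /twist; case: (boolP (C x)) => hx; case: (boolP (C y)) => hy //.
- by rewrite -{1}(star_commute_z (displacement c (sheet y)) hx).
- by rewrite -{1}(star_commute_z (displacement c (sheet x)) hy).
- by rewrite (sheet_commute vx vy hx hy cxy).
Qed.

Definition ext_twist_fun c (x : ext_vertex E) : ext_vertex E :=
  exist _ (twist c (sval x))
    (asboolT (twist_vertex c (asboolW (svalP x)))).

Lemma ext_twistD (c d : nat -> int) (x : ext_vertex E) :
  ext_twist_fun (fun i => c i + d i)%R x = ext_twist_fun c (ext_twist_fun d x).
Proof. by apply: val_inj; apply: twistD. Qed.

Lemma ext_twist0 (x : ext_vertex E) : ext_twist_fun (fun=> 0%R) x = x.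
Proof. by apply: val_inj; apply: twist0. Qed.

Lemma ext_twistK c :
  cancel (ext_twist_fun c) (ext_twist_fun (fun i => - c i)%R).
Proof.
move=> x; rewrite -ext_twistD -[RHS]ext_twist0; congr ext_twist_fun.
by apply/funext => i; rewrite addNr.
Qed.

Lemma ext_twistVK c :
  cancel (ext_twist_fun (fun i => - c i)%R) (ext_twist_fun c).
Proof.
move=> x; rewrite -ext_twistD -[RHS]ext_twist0; congr ext_twist_fun.
by apply/funext => i; rewrite addrN.
Qed.

Lemma ext_twist_commute c (x y : ext_vertex E) :
  commute (sval x) (sval y) ->
  commute (sval (ext_twist_fun c x)) (sval (ext_twist_fun c y)).
Proof. exact: twist_commute (asboolW (svalP x)) (asboolW (svalP y)). Qed.

Lemma ext_twist_edge c (x y : ext_vertex E) :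
  ext_graph E (ext_twist_fun c x) (ext_twist_fun c y) = ext_graph E x y.
Proof.
rewrite /ext_graph /= (can_eq (ext_twistK c)); congr (_ && _).
apply/eqP/eqP => [|h]; last exact: ext_twist_commute.
move=> h; rewrite -(ext_twistK c x) -(ext_twistK c y).
exact: ext_twist_commute.
Qed.

Definition ext_twist c : graph_aut (ext_graph E) :=
  GraphAut (ext_twistK c) (ext_twistVK c) (ext_twist_edge c).

Lemma ext_twistM (c d : nat -> int) :
  ext_twist (fun i => c i + d i)%R = ext_twist c * ext_twist d.
Proof. by apply: graph_aut_eq => x; apply: ext_twistD. Qed.

(** * Faithfulness of the action by twists *)

Definition exponent_word (z : V) u : int :=
  foldr (fun a n => ((if a.1 == z then sign_of a.2 else 0) + n)%R) 0%R u.

Lemma exponent_cat z u w :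
  exponent_word z (u ++ w) = (exponent_word z u + exponent_word z w)%R.
Proof. by elim: u => [|a u IH] /=; rewrite ?add0r // IH addrA. Qed.

(** The exponent sum of a generator is the corresponding coordinate of the
abelianization. *)
Lemma exponent_rel z u w :
  raag_rel E u w -> exponent_word z u = exponent_word z w.
Proof.
elim=> [//|? ? _ //|? ? ? _ -> _ -> //|s t a b|s t a b _];
  rewrite !exponent_cat /=; first by case: eqP; case: b => _ /=; lia.
by rewrite [(_ + (_ + 0))%R]addrCA.
Qed.

Lemma star_gen_nonadjacent (w : V) : w != v -> ~~ E v w -> ~~ C (gen w).
Proof.
move=> wv nE; apply/negP => /asboolP[u hu].
move=> /(@raag_of_wordP _ E) /(@exponent_rel w) /=; rewrite eqxx.
suff -> : exponent_word w u = 0%R by [].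
elim: u hu => //= -[a b] u IH /andP[ha /IH ->]; rewrite addr0 /=.
by case: eqP ha => // ->; rewrite /in_star /= (negPf wv) (negPf nE).
Qed.

(** On the conjugate of [w] that lies in the region [2 ^+ k], a twist by [c] moves
the region by [c k * 2 ^+ k.+1], which determines [c k]. *)
Lemma ext_twist_inj (w : V) : w != v -> ~~ E v w -> injective ext_twist.
Proof.
move=> wv nE c d ecd; apply/funext => k.
have nw := star_gen_nonadjacent wv nE.
pose x := gen w ^ expgz (gen v) (2 ^+ k - sheet (gen w))%R.
have nx : ~~ C x by rewrite starJ ?star_vz.
have sx : sheet x = (2 ^+ k)%R by rewrite sheetJ // addrC subrK.
have vx : is_vertex x by exists w; eexists.
pose X : ext_vertex E := exist _ x (asboolT vx).
have := congr1 (fun f : graph_aut (ext_graph E) => sheet (sval (f X))) ecd.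
rewrite /= !sheet_twist // sx => /addrI.
have v2 : val2 (2 ^+ k)%R = k by rewrite -[RHS](val2_odd k 0) mulr0 addr0 mulr1.
rewrite /displacement v2 expf_eq0 /= andbF.
by apply: mulIf; rewrite expf_eq0 andbF.
Qed.

End Sheets.

(** * Uncountability and the theorem *)

(** Cantor's diagonal argument, applied to a map from sequences to natural
numbers. *)
Lemma not_countable_of_sequences (T : Type) (F : (nat -> int) -> T) :
  injective F -> ~ countable [set: T]%classic.
Proof.
move=> Finj /countable_injP[r rinj].
have rF c d : r (F c) = r (F d) -> c = d.
  by move=> h; apply/Finj/rinj => //; apply/mem_set.
pose d k : int := if `[< exists2 c, r (F c) = k & c k = 0%R >] then 1%R else 0%R.
case: (asboolP (exists2 c, r (F c) = r (F d) & c (r (F d)) = 0%R)) => h.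
  have d1 : d (r (F d)) = 1%R by rewrite {1}/d asboolT.
  by case: h => c /rF ->; rewrite d1.
by case: (h); exists d => //; rewrite {1}/d asboolF.
Qed.

Lemma anti_connected_nonadjacent (V : finType) (E : rel V) :
  (1 < #|V|)%N -> anti_connected_graph E ->
  exists v w : V, w != v /\ ~~ E v w.
Proof.
move=> /card_gt1P[a [b [_ _ ab]]] /(_ a b)/connectP[[|c p] /=].
  by move=> _ e; rewrite e eqxx in ab.
by move=> /andP[/andP[ac nE] _] _; exists a, c; rewrite eq_sym.
Qed.

Theorem theorem66 (V : finType) (E : rel V)
  (E_sym : symmetric E) (E_irr : irreflexive E)
  (V_gt1 : (1 < #|V|)%N)
  (E_conn : connected_graph E) (E_anti : anti_connected_graph E) :
  contains_free_abelian_infinite_rank (graph_aut (ext_graph E)) /\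
  ~ countable [set: graph_aut (ext_graph E)]%classic.
Proof.
have [v [w [wv nE]]] := anti_connected_nonadjacent V_gt1 E_anti.
have inj := ext_twist_inj (E_sym := E_sym) wv nE.
split; last exact: not_countable_of_sequences inj.
exists (fun x => ext_twist E_sym v (fun i => coeff i x)); split.
  move=> x y /inj e; apply/eqP/freeg_eqP => i.
  exact: (congr1 (fun f : nat -> int => f i) e).
move=> x y; rewrite -ext_twistM; congr ext_twist.
by apply/funext => i; rewrite coeffD.
Qed.
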